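(* Let $p$ be a prime and $n$ a non-negative integer, and let $P$ and $Q$ be finite groups, both of order $p^n$ and both belonging to the class $CP_2$. Then the following statements are equivalent: (1) $\psi(P)=\psi(Q)$; (2) $|\Omega_i(P)|=|\Omega_i(Q)|$ for all $i\in\mathbb{N}$; (3) $\psi(\Omega_i(P))=\psi(\Omega_i(Q))$ for all $i\in\mathbb{N}$.
   Context: For a finite group $G$ and $x\in G$, $o(x)$ is the order of $x$. For a finite group $G$ (or a subset $H$ of it), $\psi(H)=\sum_{x\in H}o(x)$. $CP_2$ is the class of finite groups $G$ such that $o(xy)\le\max\{o(x),o(y)\}$ for all $x,y\in G$. For a finite $p$-group $G$ and $i\in\mathbb{N}$, $\Omega_i(G)=\langle\{x\in G : x^{p^i}=1\}\rangle$ is the subgroup generated by all $x\in G$ with $x^{p^i}=1$. *)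

(* Defs.v *)
From mathcomp Require Import all_boot all_fingroup all_solvable.

Set Implicit Arguments.
Unset Strict Implicit.
Unset Printing Implicit Defensive.

Local Open Scope group_scope.

Definition psi (gT : finGroupType) (A : {set gT}) : nat :=
  (\sum_(x in A) #[x])%N.

Definition CP2 (gT : finGroupType) (A : {set gT}) : Prop :=
  {in A &, forall x y, #[x * y] <= maxn #[x] #[y]}.

(* MathComp's 'Ohm_i(G) is not indexed by a prime: it is generated by the
   x \in G with x ^+ (pdiv #[x] ^ i) = 1.  When G is a p-group these are the
   x \in G with x ^+ (p ^ i) = 1, since pdiv #[x] = p for x != 1; see OhmE. *)
Lemma Ohm_pgroupE (gT : finGroupType) (p n i : nat) (G : {group gT}) :
    prime p -> #|G| = (p ^ n)%N ->
  'Ohm_i(G) = <<[set x in G | x ^+ (p ^ i) == 1]>>.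
Proof.
move=> p_pr oG; have pG: p.-group G by rewrite /pgroup oG pnatX pnat_id.
by rewrite (OhmE i pG); congr <<_>>; apply/setP=> x; rewrite !inE.
Qed.

(* Main.v *)
Require Import Defs.
From mathcomp Require Import all_boot all_fingroup all_solvable.

Set Implicit Arguments.
Unset Strict Implicit.
Unset Printing Implicit Defensive.

Local Open Scope group_scope.

(** In a p-group of class CP2 the elements of order at most [p ^ i] are closed
    under multiplication, so [Ohm_i] contains nothing else and the elements of
    order exactly [p ^ i.+1] are those of [Ohm_i.+1] outside [Ohm_i].  Summing
    orders layer by layer and then by parts,
      [psi (Ohm_i) = p ^ i * |Ohm_i| - (p - 1) * \sum_(j < i) p ^ j * |Ohm_j|],
    so the orders of the omega subgroups determine every [psi (Ohm_i)], hence
    also [psi P], as [P = Ohm_n].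

    Conversely, write [|Ohm_j| = p ^ a_j].  Since [a] is nondecreasing, the
    exponents [j + a_j] in [\sum_(j < n) p ^ (j + a_j)] are pairwise distinct,
    so this sum, which [psi P] determines, is a number written in base p with
    digits 0 and 1 only; uniqueness of the expansion recovers each [a_j]. *)

Lemma sum_expn_lt (p : nat) (f : nat -> nat) (n : nat) :
    1 < p -> (forall i, f i < f i.+1) ->
  (\sum_(i < n) p ^ f i < p ^ f n)%N.
Proof.
move=> p_gt1 f_mono; elim: n => [|n IHn].
  by rewrite big_ord0 expn_gt0 ltnW.
rewrite big_ord_recr /=; apply: (@leq_trans (p ^ (f n).+1)).
  apply: (@leq_trans (p ^ f n + p ^ f n)); first by rewrite ltn_add2r.
  by rewrite addnn -mul2n expnS leq_mul2r p_gt1 orbT.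
by rewrite leq_exp2l.
Qed.

(** Uniqueness of base [p] expansions with digits 0 and 1.  The largest
    exponents agree because a sum of smaller distinct powers of [p] never
    reaches the next power; cancel the top terms and recurse. *)
Lemma sum_expn_inj (p : nat) (f g : nat -> nat) (n : nat) :
    1 < p -> (forall i, f i < f i.+1) -> (forall i, g i < g i.+1) ->
    (\sum_(i < n) p ^ f i = \sum_(i < n) p ^ g i)%N ->
  forall i, i < n -> f i = g i.
Proof.
move=> p_gt1 f_mono g_mono.
have top_le (h k : nat -> nat) m : (forall i, h i < h i.+1) ->
    (\sum_(i < m.+1) p ^ h i = \sum_(i < m.+1) p ^ k i)%N -> k m <= h m.
  move=> h_mono eq_hk; rewrite leqNgt; apply/negP=> lt_hk.
  have: (\sum_(i < m.+1) p ^ h i < p ^ (h m).+1)%N.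
    rewrite big_ord_recr /= expnS (@leq_trans (2 * p ^ h m)) //.
      by rewrite mul2n -addnn ltn_add2r sum_expn_lt.
    by rewrite leq_mul2r p_gt1 orbT.
  rewrite eq_hk big_ord_recr /= ltnNge => /negP[].
  by rewrite (leq_trans _ (leq_addl _ _)) // leq_exp2l.
elim: n => [|n IHn] // eq_fg.
have eq_n: f n = g n by apply/eqP; rewrite eqn_leq !top_le.
move: eq_fg; rewrite !big_ord_recr /= eq_n => /addIn/IHn eq_lt_n i.
by rewrite ltnS leq_eqVlt => /predU1P[-> | /eq_lt_n].
Qed.

Section CP2pGroup.

Variables (p : nat) (gT : finGroupType) (G : {group gT}).
Hypotheses (p_pr : prime p) (pG : p.-group G) (cp2G : CP2 G).

(** The CP2 bound [#[x * y] <= p ^ i] becomes divisibility, as both sides are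
    powers of [p]; so the generating set of [Ohm_i] is already a group. *)
Lemma Ohm_CP2 i : 'Ohm_i(G) = [set x in G | #[x] %| p ^ i].
Proof.
have p_gt1 := prime_gt1 p_pr.
have dvd_le x : x \in G -> (#[x] %| p ^ i) = (#[x] <= p ^ i).
  move=> Gx; have /p_natP[k ->] := mem_p_elt pG Gx.
  by rewrite dvdn_Pexp2l // leq_exp2l.
have gG : group_set [set x in G | #[x] %| p ^ i].
  apply/group_setP; split=> [|x y]; first by rewrite inE group1 order1 dvd1n.
  rewrite !inE => /andP[Gx ox] /andP[Gy oy].
  rewrite groupM //= dvd_le ?groupM // (leq_trans (cp2G Gx Gy)) //.
  by rewrite geq_max -!dvd_le ?ox.
rewrite (OhmE i pG) -[RHS](gen_set_id gG).
by congr <<_>>; apply/setP=> x; rewrite !inE -order_dvdn.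
Qed.

(** The elements gained between two consecutive omega subgroups all have
    order [p ^ i.+1]. *)
Lemma psi_OhmS i :
  (psi 'Ohm_i.+1(G) + p ^ i.+1 * #|'Ohm_i(G)|
   = psi 'Ohm_i(G) + p ^ i.+1 * #|'Ohm_i.+1(G)|)%N.
Proof.
have sO : 'Ohm_i(G) \subset 'Ohm_i.+1(G) by apply: Ohm_leq.
rewrite /psi (big_setID 'Ohm_i(G)) /= (setIidPr sO) -addnA; congr (_ + _)%N.
rewrite (eq_bigr (fun=> p ^ i.+1)%N) => [|x].
  rewrite sum_nat_const mulnC -mulnDr; congr (_ * _)%N.
  by rewrite addnC -(cardsID 'Ohm_i(G) 'Ohm_i.+1(G)) (setIidPr sO).
rewrite !Ohm_CP2 !inE => /andP[no_i /andP[Gx]].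
move: no_i; rewrite Gx /=; case/p_natP: (mem_p_elt pG Gx) => k ->.
rewrite !dvdn_Pexp2l ?prime_gt1 // -ltnNge => lt_ik le_ki.
by congr (p ^ _)%N; apply/eqP; rewrite eqn_leq le_ki.
Qed.

(** Summation by parts of the layer formula.  The order of [Ohm_j] is written
    as a power of [p] so that the sum is a base [p] expansion. *)
Lemma psi_Ohm i :
  (psi 'Ohm_i(G) + p.-1 * \sum_(j < i) p ^ (j + logn p #|'Ohm_j(G)|)
   = p ^ i * #|'Ohm_i(G)|)%N.
Proof.
elim: i => [|i IHi].
  rewrite big_ord0 muln0 addn0 Ohm0 cards1 /psi.
  by rewrite (big_pred1 1) ?order1 // => x; rewrite inE.
have cardO : (p ^ logn p #|'Ohm_i(G)| = #|'Ohm_i(G)|)%N.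
  by rewrite -card_pgroup // (pgroupS (Ohm_sub i G)).
rewrite big_ord_recr /= mulnDr expnD cardO.
apply: (@addnI (psi 'Ohm_i(G))); rewrite -psi_OhmS.
rewrite addnCA (addnA (psi 'Ohm_i(G))) IHi -mulSn prednK ?prime_gt0 //.
by rewrite expnS mulnA.
Qed.

Lemma logn_card_Ohm_mono i :
  i + logn p #|'Ohm_i(G)| < i.+1 + logn p #|'Ohm_i.+1(G)|.
Proof. by rewrite addSn ltnS leq_add2l dvdn_leq_log ?cardSg ?Ohm_leq. Qed.

Lemma Ohm_CP2_id n i : #|G| = (p ^ n)%N -> n <= i -> 'Ohm_i(G) = G.
Proof.
move=> oG le_ni; rewrite Ohm_CP2; apply/setP=> x; rewrite inE.
apply/andb_idr=> Gx; apply: dvdn_trans (order_dvdG Gx) _.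
by rewrite oG dvdn_exp2l.
Qed.

End CP2pGroup.

Theorem theorem1p1 (p n : nat) (gT rT : finGroupType)
    (P : {group gT}) (Q : {group rT}) :
  prime p ->
  #|P| = (p ^ n)%N -> #|Q| = (p ^ n)%N ->
  CP2 P -> CP2 Q ->
  (psi P = psi Q <-> (forall i : nat, #|'Ohm_i(P)| = #|'Ohm_i(Q)|)) /\
  ((forall i : nat, #|'Ohm_i(P)| = #|'Ohm_i(Q)|) <->
   (forall i : nat, psi 'Ohm_i(P) = psi 'Ohm_i(Q))).
Proof.
move=> p_pr oP oQ cp2P cp2Q.
have pP : p.-group P by rewrite /pgroup oP pnatX pnat_id.
have pQ : p.-group Q by rewrite /pgroup oQ pnatX pnat_id.
have idP i : n <= i -> 'Ohm_i(P) = P by exact: (Ohm_CP2_id p_pr pP cp2P oP).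
have idQ i : n <= i -> 'Ohm_i(Q) = Q by exact: (Ohm_CP2_id p_pr pQ cp2Q oQ).
have psi_card : psi P = psi Q -> forall i, #|'Ohm_i(P)| = #|'Ohm_i(Q)|.
  move=> eq_psi i; case: (leqP n i) => [le_ni | lt_in].
    by rewrite idP ?idQ ?oP.
  have := psi_Ohm p_pr pQ cp2Q n; have := psi_Ohm p_pr pP cp2P n.
  rewrite idP // idQ // oP oQ -eq_psi => <- /addnI/eqP.
  rewrite eqn_pmul2l ?ltn_predRL ?prime_gt1 // => /eqP/esym eq_sum.
  have /addnI eq_log := sum_expn_inj (prime_gt1 p_pr)
    (logn_card_Ohm_mono p P) (logn_card_Ohm_mono p Q) eq_sum lt_in.
  rewrite (card_pgroup (pgroupS (Ohm_sub i P) pP)) eq_log.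
  by rewrite -card_pgroup // (pgroupS (Ohm_sub i Q)).
have card_psi : (forall i, #|'Ohm_i(P)| = #|'Ohm_i(Q)|) ->
    forall i, psi 'Ohm_i(P) = psi 'Ohm_i(Q).
  move=> eq_card i; have := psi_Ohm p_pr pQ cp2Q i.
  rewrite -eq_card -(psi_Ohm p_pr pP cp2P i).
  by under eq_bigr do rewrite -eq_card; move/addIn.
have psi_top : (forall i, psi 'Ohm_i(P) = psi 'Ohm_i(Q)) -> psi P = psi Q.
  by move/(_ n); rewrite idP ?idQ.
split; split; [exact: psi_card | | exact: card_psi |].
  by move/card_psi/psi_top.
by move/psi_top/psi_card.
Qed.
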